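(* Let $K$ be a set in $\mathbb{E}^d$ and let $\mathcal{F}$ be a family of spindle starshaped sets in $\mathbb{E}^d$ such that the intersection of any countable subfamily of $\mathcal{F}$ is a spindle starshaped set whose spindle kernel contains a translate of $K$. Then $\ker_{\mathrm{s}}\big(\bigcap\mathcal{F}\big)$ also contains a translate of $K$.
   Context: For $x,y\in\mathbb{E}^d$ the spindle $[x,y]_{\mathrm{s}}$ is the intersection of all closed unit balls containing $x$ and $y$ if $|x-y|\le2$, and $\mathbb{E}^d$ otherwise. For $A\subseteq\mathbb{E}^d$, $p\in A$: $\operatorname{st}_{\mathrm{s}}(p,A)=\{q\in A:[p,q]_{\mathrm{s}}\subseteq A\}$; $\ker_{\mathrm{s}}A=\{p\in A:\operatorname{st}_{\mathrm{s}}(p,A)=A\}$; $A$ is spindle starshaped if $\ker_{\mathrm{s}}A\ne\emptyset$. *)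

(* Defs.v *)
From HB Require Import structures.
From mathcomp Require Import all_boot all_order all_algebra.
From mathcomp Require Import classical_sets cardinality reals.
Set Implicit Arguments. Unset Strict Implicit. Unset Printing Implicit Defensive.
Import Order.TTheory GRing.Theory Num.Theory.
Local Open Scope ring_scope.
Local Open Scope classical_set_scope.

Definition edist (R : realType) (d : nat) (x y : 'rV[R]_d) : R :=
  Num.sqrt (\sum_(i < d) (x ord0 i - y ord0 i) ^+ 2).

Definition cball1 (R : realType) (d : nat) (c : 'rV[R]_d) : set 'rV[R]_d :=
  [set z | edist z c <= 1].

Definition spindle (R : realType) (d : nat) (x y : 'rV[R]_d) : set 'rV[R]_d :=
  if edist x y <= 2 then
    [set z | forall c : 'rV[R]_d, cball1 c x -> cball1 c y -> cball1 c z]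
  else setT.

Definition sstar (R : realType) (d : nat) (p : 'rV[R]_d) (A : set 'rV[R]_d)
  : set 'rV[R]_d := [set q | A q /\ spindle p q `<=` A].

Definition skernel (R : realType) (d : nat) (A : set 'rV[R]_d) : set 'rV[R]_d :=
  [set p | A p /\ sstar p A = A].

Definition spindle_starshaped (R : realType) (d : nat) (A : set 'rV[R]_d) : Prop :=
  skernel A !=set0.

Definition contains_translate (R : realType) (d : nat) (K B : set 'rV[R]_d) : Prop :=
  exists t : 'rV[R]_d, [set k + t | k in K] `<=` B.

(* Main.v *)
Require Import Defs.
From HB Require Import structures.
From mathcomp Require Import all_boot all_order all_algebra.
From mathcomp Require Import boolp classical_sets functions cardinality reals.
From mathcomp Require Import topology normedtype derive realfun.
From mathcomp Require Import ring lra.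
Set Implicit Arguments. Unset Strict Implicit. Unset Printing Implicit Defensive.
Import Order.TTheory GRing.Theory Num.Theory numFieldNormedType.Exports.
Local Open Scope ring_scope.
Local Open Scope classical_set_scope.

(* Write X_G for the intersection of a countable subfamily G.  Call t good for G
   if for some countable H containing G and all k in K, k + t lies in X_G and its
   spindles to all points of X_H lie in X_G.  The good sets decrease with G, are
   nonempty by hypothesis, and are convex up to enlarging G: if t is good for G
   through H and t' is good for H, then the segment [t, t'] is good for G,
   because every w in the spindle of a point of [p1, p2] and q lies in the spindle
   of p1 and some z in the spindle of p2 and q.  As in Klee's theorem on convex
   sets, such a family has a common point, found one coordinate at a time, and
   this point translates K into the kernel of the whole intersection.

   The join property of spindles is a sandwich statement on the sets of centres:
   if the unit balls around p1, p2, q meet within the unit ball around w, there is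
   a unit ball containing the lens around p2, q and meeting the ball around p1
   within the ball around w.  Its centre is read off from Lagrange multipliers. *)

(** * Common points of directed families of semiconvex sets *)

Section CommonPoint.
Variables (R : realType) (I : Type) (le : I -> I -> Prop).
Hypothesis le_ub : forall f : rat -> I, exists u, forall r, le (f r) u.

(** Convexity up to enlarging the index: the second endpoint comes from a later set, chosen after
    the first endpoint. *)
Definition semiconvex (V : lmodType R) (C : I -> set V) : Prop :=
  forall i t, C i t -> exists2 j, le i j &
    forall t' l, C j t' -> 0 <= l <= 1 -> C i ((1 - l) *: t + l *: t').

Lemma le_ub2 i j : exists2 u, le i u & le j u.
Proof.
have [u Hu] := le_ub (fun r => if r == 0 then i else j).
exists u; first by have := Hu 0; rewrite eqxx.
by have := Hu 1; rewrite oner_eq0.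
Qed.

(* A value that is crossed from both sides cofinally belongs to every [c i] by
   semiconvexity; without such a value, countably many indices, one for each
   rational, already squeeze [c i] to a point. *)
Lemma common_point_line (c : I -> set R^o) :
  (forall i j, le i j -> c j `<=` c i) -> (forall i, c i !=set0) ->
  semiconvex c -> exists s, forall i, c i s.
Proof.
move=> c_anti c_neq0 c_conv.
have [[r [r_low r_high]]|no_crossing] := pselect (exists r : R,
    (forall i, exists2 x, c i x & x < r) /\ (forall i, exists2 x, c i x & r < x)).
  exists r => i; have [x cx xr] := r_low i.
  have [j _ cj] := c_conv i x cx.
  have [y cy ry] := r_high j.
  have yx : 0 < y - x by lra.
  have r01 : 0 <= (r - x) / (y - x) <= 1.
    by rewrite ler_pdivrMr// divr_ge0//=; lra.
  have := cj y _ cy r01.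
  suff -> : (1 - (r - x) / (y - x)) *: (x : R^o) +
    ((r - x) / (y - x)) *: (y : R^o) = r by [].
  by rewrite /GRing.scale/=; field; rewrite gt_eqF.
have side (r : rat) : exists i, (forall x, c i x -> ratr r <= x) \/
                                (forall x, c i x -> x <= ratr r).
  apply: contrapT => noi; apply: no_crossing; exists (ratr r).
  by split=> i; apply: contrapT => nox; apply: noi; exists i; [left|right] => x cx;
    rewrite leNgt; apply/negP => xr; apply: nox; exists x.
have [f fP] := choice side.
have [u fu] := le_ub f.
have u_subsingleton x y : c u x -> c u y -> ~ x < y.
  move=> cx cy /rat_in_itvoo[r]; rewrite in_itv/= => /andP[xr ry].
  have [H|H] := fP r.
    by have := H _ (c_anti _ _ (fu r) _ cx); rewrite leNgt xr.
  by have := H _ (c_anti _ _ (fu r) _ cy); rewrite leNgt ry.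
have [s cs] := c_neq0 u.
exists s => i; have [v uv iv] := le_ub2 u i.
have [x cx] := c_neq0 v.
have [xs|sx|xs] := ltgtP x s.
- by case: (u_subsingleton x s (c_anti _ _ uv _ cx) cs xs).
- by case: (u_subsingleton s x cs (c_anti _ _ uv _ cx) sx).
- by rewrite -xs; exact: c_anti iv _ cx.
Qed.

(** The slices of the [C i] by the coordinates already fixed project to a semiconvex family on the
    next axis, where the one-dimensional case gives a common value. *)
Lemma common_point (d : nat) (C : I -> set 'rV[R]_d) :
  (forall i j, le i j -> C j `<=` C i) -> (forall i, C i !=set0) ->
  semiconvex C -> exists s, forall i, C i s.
Proof.
move=> C_anti C_neq0 C_conv.
suff H n : (n <= d)%N -> exists s : 'rV[R]_d, forall i, exists2 x, C i x &
    forall k : 'I_d, (k < n)%N -> x ord0 k = s ord0 k.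
  have [s Hs] := H d (leqnn d); exists s => i; have [x Cx xs] := Hs i.
  by have -> : s = x by apply/rowP => k; rewrite xs.
elim: n => [_|n IHn nd].
  by exists 0 => i; have [x Cx] := C_neq0 i; exists x.
have [s Hs] := IHn (ltnW nd).
pose m := Ordinal nd.
pose c i : set R^o := [set x ord0 m | x in
  [set x | C i x /\ forall k : 'I_d, (k < n)%N -> x ord0 k = s ord0 k]].
have [r Hr] : exists r, forall i, c i r.
  apply: common_point_line.
  - by move=> i j ij _ [x [Cx xs] <-]; exists x => //; split=> //; exact: C_anti Cx.
  - by move=> i; have [x Cx xs] := Hs i; exists (x ord0 m), x.
  - move=> i _ [x [Cx xs] <-]; have [j ij Cj] := C_conv i x Cx.
    exists j => // _ l [y [Cy ys] <-] l01.
    exists ((1 - l) *: x + l *: y); last by rewrite !mxE.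
    split=> [|k kn]; first exact: Cj.
    by rewrite !mxE xs// ys//; ring.
exists (\row_k if (k < n)%N then s ord0 k else r) => i.
have [x [Cx xs] xr] := Hr i.
exists x => // k; rewrite ltnS leq_eqVlt mxE => /orP[/eqP kn|kn].
  by rewrite kn ltnn -xr; congr (x _ _); apply: val_inj.
by rewrite kn xs.
Qed.

End CommonPoint.

(** * Inner products, spindles and the join certificate *)

Section Dot.
Variables (R : realType) (d : nat).
Implicit Types (u v w x : 'rV[R]_d) (a : R).

Definition dot u v : R := \sum_(i < d) u ord0 i * v ord0 i.
Definition nsq u : R := dot u u.

Lemma dotC u v : dot u v = dot v u.
Proof. by apply: eq_bigr => i _; rewrite mulrC. Qed.

Lemma dotDl u v w : dot (u + v) w = dot u w + dot v w.
Proof. by rewrite -big_split; apply: eq_bigr => i _; rewrite mxE mulrDl. Qed.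

Lemma dotZl a u v : dot (a *: u) v = a * dot u v.
Proof. by rewrite mulr_sumr; apply: eq_bigr => i _; rewrite mxE mulrA. Qed.

Lemma dotDr u v w : dot u (v + w) = dot u v + dot u w.
Proof. by rewrite dotC dotDl !(dotC u). Qed.

Lemma dotZr a u v : dot u (a *: v) = a * dot u v.
Proof. by rewrite dotC dotZl (dotC u). Qed.

Lemma dotNl u v : dot (- u) v = - dot u v.
Proof. by rewrite -scaleN1r dotZl mulN1r. Qed.

Lemma dotNr u v : dot u (- v) = - dot u v.
Proof. by rewrite dotC dotNl dotC. Qed.

Lemma dot0l u : dot 0 u = 0.
Proof. by rewrite -(scale0r 0) dotZl mul0r. Qed.

Lemma dot0r u : dot u 0 = 0.
Proof. by rewrite dotC dot0l. Qed.

Lemma dot_sumr n (l : 'I_n -> R) (U : 'I_n -> 'rV[R]_d) u :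
  dot u (\sum_i l i *: U i) = \sum_i l i * dot u (U i).
Proof.
by elim/big_rec2: _ => [|i a v _ <-]; rewrite ?dot0r// dotDr dotZr.
Qed.

Lemma nsq_ge0 u : 0 <= nsq u.
Proof. by apply: sumr_ge0 => i _; rewrite -expr2 sqr_ge0. Qed.

Lemma nsq_eq0 u : nsq u = 0 -> u = 0.
Proof.
move=> /eqP; rewrite psumr_eq0 => [/allP u0|i _]; last by rewrite -expr2 sqr_ge0.
apply/rowP => i; have := u0 i; rewrite mem_index_enum => /(_ isT).
by rewrite mulf_eq0 orbb mxE => /eqP.
Qed.

Lemma nsqD u v : nsq (u + v) = nsq u + 2 * dot u v + nsq v.
Proof. by rewrite /nsq dotDl !dotDr (dotC v u); ring. Qed.

Lemma nsqB u v : nsq (u - v) = nsq u - 2 * dot u v + nsq v.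
Proof. by rewrite nsqD dotNr /nsq dotNl dotNr; ring. Qed.

Lemma nsqBC u v : nsq (u - v) = nsq (v - u).
Proof. by rewrite !nsqB dotC; ring. Qed.

Lemma nsqN u : nsq (- u) = nsq u.
Proof. by rewrite /nsq dotNl dotNr opprK. Qed.

Lemma nsqZ a u : nsq (a *: u) = a ^+ 2 * nsq u.
Proof. by rewrite /nsq dotZl dotZr; ring. Qed.

Lemma edistE u v : Defs.edist u v = Num.sqrt (nsq (u - v)).
Proof.
by congr Num.sqrt; apply: eq_bigr => i _; rewrite !mxE expr2.
Qed.

Lemma edist_le1 u v : (Defs.edist u v <= 1) = (nsq (u - v) <= 1).
Proof. by rewrite edistE -{1}sqrtr1 ler_sqrt. Qed.

Lemma nsq_convex a u v : 0 <= a <= 1 ->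
  nsq ((1 - a) *: u + a *: v) <= (1 - a) * nsq u + a * nsq v.
Proof.
move=> /andP[a0 a1]; rewrite nsqD !nsqZ dotZl dotZr.
have := nsq_ge0 (u - v); rewrite nsqB => H.
have : 0 <= a * (1 - a) * (nsq u - 2 * dot u v + nsq v).
  by rewrite mulr_ge0// mulr_ge0// subr_ge0.
nra.
Qed.

(** By the parallelogram law no unit ball contains two points more than 2 apart, so the condition is
    then vacuous and agrees with [setT]. *)
Lemma spindleP u v w : spindle u v w <->
  forall c, nsq (u - c) <= 1 -> nsq (v - c) <= 1 -> nsq (w - c) <= 1.
Proof.
rewrite /spindle; case: ifPn => [_|uv2].
  by split=> H c; have := H c; rewrite /cball1/= !edist_le1.
split=> // _ c uc vc; exfalso; move/negP: uv2; apply.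
rewrite edistE -[leRHS]ger0_norm// -sqrtr_sqr ler_sqrt ?sqr_ge0//.
have := nsq_ge0 (u - c + (v - c)); rewrite nsqD => H.
rewrite (_ : u - v = (u - c) - (v - c)) ?(nsqB (u - c)); first by rewrite expr2; lra.
by rewrite opprB addrA subrK.
Qed.

Lemma spindle_segment u v a : 0 <= a <= 1 -> spindle u v ((1 - a) *: u + a *: v).
Proof.
move=> a01; apply/spindleP => c uc vc.
have -> : (1 - a) *: u + a *: v - c = (1 - a) *: (u - c) + a *: (v - c).
  by rewrite !scalerBr addrACA -opprD -scalerDl subrK scale1r.
apply: (le_trans (nsq_convex _ _ a01)).
by move/andP: a01 => [a0 a1]; nra.
Qed.

(* With [A1], [A2], [A3], [W] the vectors [a - p1], [a - p2], [a - q], [a - w],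
   this turns a balance of the [a - p_i] at a point [a] into a point
   [z = a - Z] with [w] in the spindle of [p1, z] and [z] in that of [p2, q].
   The case [m = 0 /\ 1 < rho] is the one where no unit ball contains
   [p1, p2, q]. *)
Lemma join_certificate (A1 A2 A3 W : 'rV[R]_d) (l1 l2 l3 m rho : R) :
  0 <= l1 -> 0 <= l2 -> 0 <= l3 -> 0 <= m -> l1 + l2 + l3 + m = 1 ->
  l1 * nsq A1 = l1 * rho ^+ 2 -> l2 * nsq A2 = l2 * rho ^+ 2 ->
  l3 * nsq A3 = l3 * rho ^+ 2 ->
  l1 *: A1 + l2 *: A2 + l3 *: A3 = m *: W ->
  (rho = 1 /\ nsq W = 1) \/ (1 < rho /\ m = 0) ->
  exists Z, (forall e, nsq (e + A2) <= 1 -> nsq (e + A3) <= 1 -> nsq (e + Z) <= 1) /\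
            (forall e, nsq (e + A1) <= 1 -> nsq (e + Z) <= 1 -> nsq (e + W) <= 1).
Proof.
move=> l1_ge0 l2_ge0 l3_ge0 m_ge0 sum1 E1 E2 E3 bal cases.
have rho_ge1 : 1 <= rho by case: cases => [[-> _]|[/ltW]].
pose N := l2 *: A2 + l3 *: A3.
have balN : l1 *: A1 + N = m *: W by rewrite -bal addrA.
(* [A] is known to have norm [rho] only where [l] is nonzero, hence the weight [l] on both sides. *)
have ball l A e : 0 <= l -> l * nsq A = l * rho ^+ 2 -> nsq (e + A) <= 1 ->
    2 * l * dot e A <= l * (1 - rho ^+ 2 - nsq e).
  by move=> l0 EA; rewrite nsqD => H; have := ler_wpM2l l0 H; nra.
have lensN e : nsq (e + A2) <= 1 -> nsq (e + A3) <= 1 ->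
    2 * dot e N <= (l2 + l3) * (1 - rho ^+ 2 - nsq e).
  move=> /(ball _ _ _ l2_ge0 E2) + /(ball _ _ _ l3_ge0 E3).
  by rewrite dotDr !dotZr; lra.
(* If [N = 0] and [0 < l2 + l3], the lens is at most the point [e = 0]; if [l2 = l3 = 0], the
   balance forces [A1 = W], or is impossible when [1 < rho]. *)
have [N0|N_neq0] := eqVneq N 0.
  have [l23|l23] := ltP 0 (l2 + l3).
    exists W; split=> // e /lensN /[apply]; rewrite N0 dot0r mulr0 pmulr_rge0//.
    move=> He; have e0 := nsq_ge0 e.
    case: cases => [[r1 W1]|[r1 _]]; last by nra.
    by rewrite (nsq_eq0 (u := e)) ?add0r ?W1//; move: He; rewrite r1; lra.
  have [l20 l30] : l2 = 0 /\ l3 = 0 by split; lra.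
  have l1m : l1 *: A1 = m *: W by rewrite -balN N0 addr0.
  have : nsq (l1 *: A1) = nsq (m *: W) by rewrite l1m.
  rewrite !nsqZ expr2 -mulrA E1 => EE.
  case: cases => [[r1 W1]|[r1 m0]].
    have l1E : l1 = m by move: EE; rewrite W1 r1; nra.
    have AW : A1 = W.
      by apply: (scalerI (a := l1)); [apply/eqP; lra|rewrite l1m l1E].
    by exists A3; rewrite AW.
  have l11 : l1 = 1 by lra.
  by move: EE; rewrite m0 l11; nra.
pose nu := Num.sqrt (nsq N).
have nu2 : nu ^+ 2 = nsq N by rewrite sqr_sqrtr ?nsq_ge0.
have nu_gt0 : 0 < nu.
  rewrite sqrtr_gt0 lt_neqAle nsq_ge0 andbT eq_sym.
  by apply: contra_neq N_neq0 => /nsq_eq0.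
have nu_le : nu <= (l2 + l3) * rho.
  rewrite -ler_sqr ?nnegrE ?(ltW nu_gt0)//; last by rewrite mulr_ge0//; lra.
  rewrite nu2 nsqD !nsqZ dotZl dotZr.
  have : 0 <= l2 * l3 * nsq (A2 - A3) by rewrite !mulr_ge0 ?nsq_ge0.
  rewrite nsqB.
  nra.
have nu_neq0 : nu != 0 by rewrite gt_eqF.
(* [N] rescaled to norm [rho]; by [nu_le] the scaling turns the coefficient [l2 + l3] into one that
   is at least 1. *)
exists ((rho / nu) *: N); split=> e.
  move=> e2 e3; have := lensN e e2 e3.
  have e0 := nsq_ge0 e.
  rewrite nsqD nsqZ dotZr -nu2.
  rewrite (_ : (rho / nu) ^+ 2 * nu ^+ 2 = rho ^+ 2); last by field.
  move=> H.
  have : rho / nu * (2 * dot e N) <= rho / nu * ((l2 + l3) * (1 - rho ^+ 2 - nsq e)).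
    by rewrite ler_wpM2l// divr_ge0 ?(ltW nu_gt0)//; lra.
  have : 1 <= rho / nu * (l2 + l3).
    by rewrite mulrAC ler_pdivlMr// mul1r mulrC.
  set k := rho / nu; rewrite mulrA => kl K.
  have : (k * (l2 + l3) - 1) * (1 - rho ^+ 2 - nsq e) <= 0.
    by rewrite mulr_ge0_le0 ?subr_ge0//; nra.
  by lra.
move=> e1 eZ.
have H1 := ball _ _ _ l1_ge0 E1 e1.
have H2 : 2 * dot e N <= nu / rho * (1 - rho ^+ 2 - nsq e).
  move: eZ; rewrite nsqD nsqZ dotZr -nu2.
  rewrite (_ : (rho / nu) ^+ 2 * nu ^+ 2 = rho ^+ 2); last by field.
  move=> H; rewrite mulrAC ler_pdivlMr; last by lra.
  have : nu * (2 * (rho / nu * dot e N)) <= nu * (1 - rho ^+ 2 - nsq e).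
    by rewrite ler_wpM2l ?(ltW nu_gt0)//; lra.
  rewrite (_ : nu * (2 * (rho / nu * dot e N)) = 2 * dot e N * rho)//.
  by field.
have H : 2 * m * dot e W <= (l1 + nu / rho) * (1 - rho ^+ 2 - nsq e).
  by rewrite -mulrA -dotZr -balN dotDr dotZr; lra.
have nr : 0 < nu / rho by rewrite divr_gt0//; lra.
have e0 := nsq_ge0 e.
case: cases => [[r1 W1]|[r1 m0]]; last first.
  move: H; rewrite m0 mulr0 mul0r pmulr_rge0; last by lra.
  by nra.
(* Triangle inequality for [m *: W = l1 *: A1 + N], with [rho = 1]. *)
have m_le : m <= l1 + nu / rho.
  rewrite r1 divr1 -ler_sqr ?nnegrE ?addr_ge0 ?(ltW nu_gt0)//.
  have -> : m ^+ 2 = nsq (m *: W) by rewrite nsqZ W1 mulr1.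
  rewrite -balN nsqD nsqZ -nu2 dotZl expr2 -mulrA E1 r1.
  have : l1 * dot A1 N <= l1 * nu.
    have : 0 <= l1 * nsq (nu *: A1 - N).
      by rewrite mulr_ge0 ?nsq_ge0.
    rewrite nsqB nsqZ dotZl -nu2.
    have : nu * (2 * (l1 * dot A1 N)) <= nu * (2 * (l1 * nu)) -> l1 * dot A1 N <= l1 * nu.
      by rewrite ler_pM2l// ler_pM2l.
    move=> K Hn; apply: K.
    have : l1 * nsq A1 * nu ^+ 2 = l1 * nu ^+ 2 by rewrite E1 r1; ring.
    nra.
  nra.
have [m0|m_gt0] := leP m 0.
  have mm : m = 0 by lra.
  have e_eq0 : e = 0 by apply: nsq_eq0; move: H; rewrite mm r1; nra.
  by rewrite e_eq0 add0r W1.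
rewrite nsqD W1.
suff : m * (nsq e + 2 * dot e W) <= m * 0 by rewrite ler_pM2l//; lra.
have : 0 <= (l1 + nu / rho - m) * nsq e by rewrite mulr_ge0// subr_ge0.
by move: H; rewrite r1 expr1n; lra.
Qed.

End Dot.

(** * The join property of spindles *)

Section Join.
Variables (R : realType) (d : nat).
Implicit Types (u v w x p q : 'rV[R]_d).

Lemma coord_rV_continuous n (i : 'I_n) : continuous (fun x : 'rV[R]_n => x ord0 i).
Proof. exact: coord_continuous. Qed.

Lemma nsq_continuous : continuous (@nsq R d).
Proof.
apply: (@continuous_big _ _ _ _ _ (@add_continuous R^o)) => i _ x.
exact: (cvgM (@coord_rV_continuous _ i x) (@coord_rV_continuous _ i x)).
Qed.

Lemma box_compact n (A : set 'rV[R]_n) (a b : 'I_n -> R) : closed A ->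
  (forall (x : 'rV[R]_n) i, A x -> a i <= x ord0 i <= b i) -> compact A.
Proof.
move=> cA Aab; apply: (subclosed_compact cA).
  apply: (rV_compact (A := fun i => `[a i, b i])) => i.
  exact: segment_compact.
by move=> x Ax i /=; rewrite in_itv/= Aab.
Qed.

Lemma coord_le_nsq u i : u ord0 i ^+ 2 <= nsq u.
Proof.
rewrite /nsq /dot (bigD1 i)//= expr2 lerDl.
by apply: sumr_ge0 => j _; rewrite -expr2 sqr_ge0.
Qed.

(* First order conditions, at the vertices, for the minimum over the simplex of
   [nsq (\sum_i l i *: U i) + \sum_i l i * D i]. *)
Lemma simplex_lagrange n (U : 'I_n.+1 -> 'rV[R]_d) (D : 'I_n.+1 -> R) :
  exists l : 'I_n.+1 -> R, [/\ forall i, 0 <= l i, \sum_i l i = 1 &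
    let y := \sum_i l i *: U i in
    forall j, 2 * nsq y + \sum_i l i * D i <= 2 * dot y (U j) + D j].
Proof.
pose S : set 'rV[R]_n.+1 :=
  (\bigcap_(i in setT) [set l | 0 <= l ord0 i]) `&` [set l | \sum_i l ord0 i = 1].
have S0 : S !=set0.
  exists (delta_mx ord0 ord0); split=> [i _ /=|/=]; first by rewrite mxE ler0n.
  rewrite (bigD1 ord0)//= big1 => [|i i0]; first by rewrite mxE !eqxx addr0.
  by rewrite mxE (negPf i0) andbF.
have cS : compact S.
  apply: (@box_compact _ _ (fun=> 0) (fun=> 1)).
    apply: closedI.
      apply: closed_bigI => i _.
      apply: (preimage_closed (f := fun l : 'rV[R]_n.+1 => l ord0 i)) (@closed_ge R 0).
      by move=> x _; exact: coord_rV_continuous.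
    apply: (preimage_closed (f := fun l : 'rV[R]_n.+1 => \sum_i l ord0 i))
      (@closed_eq R 1).
    move=> x _; apply: (@continuous_big _ _ _ _ _ (@add_continuous R^o)) => i _ {}x.
    exact: coord_rV_continuous.
  move=> l i [l0 l1]; rewrite l0//= -l1 (bigD1 i)//= lerDl.
  by apply: sumr_ge0 => j _; exact: l0.
pose f (l : 'rV[R]_n.+1) := nsq (\sum_i l ord0 i *: U i) + \sum_i l ord0 i * D i.
have cU : continuous (fun l : 'rV[R]_n.+1 => \sum_i l ord0 i *: U i).
  apply: (@continuous_big _ _ _ _ _ (@add_continuous 'rV[R]_d)) => i _ l.
  exact: (cvgZr_tmp (@coord_rV_continuous _ i l)).
have cD : continuous (fun l : 'rV[R]_n.+1 => \sum_i l ord0 i * D i).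
  apply: (@continuous_big _ _ _ _ _ (@add_continuous R^o)) => i _ l.
  exact: (cvgMr_tmp (@coord_rV_continuous _ i l)).
have cf : continuous f.
  by move=> l; apply: (cvgD _ (cD l)); exact: (cvg_comp _ _ (cU l) (@nsq_continuous _)).
have [l lS l_min] := compact_EVT_min S0 cS (continuous_subspaceT cf).
have {lS} [l_ge0 l_sum] := set_mem lS.
exists (fun i => l ord0 i); split=> // [i|]; first exact: l_ge0.
move=> y j.
set m := \sum_i l ord0 i * D i.
pose q := nsq (U j - y); pose c := 2 * dot y (U j - y) + D j - m.
(* Moving from the minimizer towards vertex [j] by [t] changes the objective by
   [t * (c + t * q)]. *)
have H t : 0 <= t <= 1 -> 0 <= t * (c + t * q).
  move=> /andP[t0 t1].
  pose lt : 'rV[R]_n.+1 := (1 - t) *: l + t *: delta_mx ord0 j.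
  have ltE i : lt ord0 i = (1 - t) * l ord0 i + t * (i == j)%:R by rewrite !mxE eqxx.
  have ltS : lt \in S.
    rewrite inE; split=> [i _ /=|/=].
      by rewrite ltE addr_ge0// mulr_ge0// ?ler0n ?subr_ge0//; exact: l_ge0.
    under eq_bigr do rewrite ltE.
    rewrite big_split/= -!mulr_sumr l_sum (bigD1 j)//= eqxx big1 ?addr0 => [|i ij].
      by rewrite !mulr1 subrK.
    by rewrite (negPf ij).
  have := l_min _ ltS; rewrite /f -/y -/m.
  have -> : \sum_i lt ord0 i *: U i = y + t *: (U j - y).
    under eq_bigr do rewrite ltE scalerDl -!scalerA.
    rewrite big_split/= -!scaler_sumr -/y scalerBl scale1r scalerBr addrAC -addrA.
    congr (_ + (_ *: _ - _)).
    rewrite (bigD1 j)//= eqxx scale1r big1 ?addr0// => i ij.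
    by rewrite (negPf ij) scale0r.
  have -> : \sum_i lt ord0 i * D i = (1 - t) * m + t * D j.
    under eq_bigr do rewrite ltE mulrDl -!mulrA.
    rewrite big_split/= -!mulr_sumr; congr (_ + _ * _).
    rewrite (bigD1 j)//= eqxx mul1r big1 ?addr0// => i ij.
    by rewrite (negPf ij) mul0r.
  by rewrite nsqD nsqZ dotZr /c /q; lra.
suff : 0 <= c by rewrite /c dotDr dotNr /nsq; lra.
rewrite leNgt; apply/negP => c_lt0.
have q_ge0 : 0 <= q by exact: nsq_ge0.
have qc : 0 < q - c by lra.
(* This parameter lies in the unit interval and makes [c + t * q] negative, even when [q = 0]. *)
have := H (- c / (q - c)).
rewrite divr_ge0 ?ler_pdivrMr//; [|lra|lra].
have -> : 1 * (q - c) = q - c by ring.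
have -> : - c <= q - c by lra.
move=> /(_ isT).
rewrite (_ : c + _ = - (c ^+ 2 / (q - c))); last by field; rewrite gt_eqF.
rewrite mulrN oppr_ge0 leNgt => /negP; apply.
by rewrite mulr_gt0// divr_gt0// ?exprn_even_gt0 ?oppr_gt0//= ?lt_eqF.
Qed.

(** The certificate needs a point of [L] at distance exactly 1 from [w]. Pushing [w] away from [p]
    until it is about to leave the ball around some point of [L] provides one; compactness makes
    this first exit attained. *)
Lemma farthest_on_ray (L : set 'rV[R]_d) p w : compact L -> L !=set0 -> w != p ->
  (forall x, L x -> nsq (x - p) <= 1 /\ nsq (x - w) <= 1) ->
  exists2 s, 1 <= s & let w' := p + s *: (w - p) in
    (forall x, L x -> nsq (x - w') <= 1) /\ exists2 a, L a & nsq (a - w') = 1.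
Proof.
move=> cL L0 wp Lpw.
pose e := w - p; pose E := nsq e.
have E_gt0 : 0 < E.
  rewrite lt_neqAle nsq_ge0 andbT eq_sym.
  by apply: contra_neq wp => /nsq_eq0/subr0_eq.
(* [f x / E] is the parameter at which the ray from [p] through [w] leaves the
   unit ball around [x]. *)
pose D x := dot e (x - p) ^+ 2 + E * (1 - nsq (x - p)).
pose f x := dot e (x - p) + Num.sqrt (D x).
have D_ge0 x : L x -> 0 <= D x.
  by move=> /Lpw[xp _]; rewrite addr_ge0 ?sqr_ge0// mulr_ge0 ?(ltW E_gt0)// subr_ge0.
have nsq_ray x s : E * nsq (x - (p + s *: e)) =
    (E * s - dot e (x - p)) ^+ 2 - D x + E.
  rewrite opprD addrA nsqB nsqZ dotZr (dotC _ e) /D /E; ring.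
have cB : continuous (fun x => x - p).
  by move=> x; exact: (cvgB cvg_id (cvg_cst _)).
have cdot : continuous (fun x => dot e (x - p)).
  have ce : continuous (dot e).
    apply: (@continuous_big _ _ _ _ _ (@add_continuous R^o)) => i _ x.
    exact: (cvgMl_tmp (@coord_rV_continuous _ i x)).
  by move=> x; exact: (cvg_comp _ _ (cB x) (ce _)).
have cN : continuous (fun x => 1 - nsq (x - p)).
  have cnB : continuous (fun x => nsq (x - p)).
    by move=> x; exact: (cvg_comp _ _ (cB x) (@nsq_continuous _)).
  by move=> x; exact: (cvgB (cvg_cst _) (cnB x)).
have cD : continuous D.
  by move=> x; apply: (cvgD (cvgM (cdot x) (cdot x))); exact: (cvgMl_tmp (cN x)).
have cf : continuous f.
  by move=> x; apply: (cvgD (cdot x));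
     exact: (cvg_comp _ _ (cD x) (@sqrt_continuous _ _)).
have [a aL a_min] := compact_EVT_min L0 cL (continuous_subspaceT cf).
have {}aL := set_mem aL.
(* [w] has parameter 1 and lies in the ball around [a], so the exit is not earlier. *)
have fa_ge : E <= f a.
  rewrite /f -lerBlDl.
  have [E_le|E_gt] := leP (E - dot e (a - p)) 0; first exact: le_trans (sqrtr_ge0 _).
  rewrite -ler_sqr ?nnegrE ?(ltW E_gt) ?sqrtr_ge0// sqr_sqrtr ?D_ge0//.
  have [_ aw] := Lpw a aL.
  have := nsq_ray a 1; rewrite scale1r (_ : p + e = w); last by rewrite /e addrC subrK.
  by rewrite mulr1; nra.
exists (f a / E); first by rewrite ler_pdivlMr// mul1r.
have fE x : E * (f x / E) = f x by field; rewrite gt_eqF.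
split=> [x Lx|].
  rewrite -(ler_pM2l E_gt0) mulr1 nsq_ray fE gerDr subr_le0.
  have [xp _] := Lpw x Lx.
  rewrite -(sqr_sqrtr (D_ge0 x Lx)) -subr_ge0 subr_sqr mulr_ge0//.
    by have := a_min x (mem_set Lx); rewrite {2}/f; lra.
  (* [p] lies in the ball around [x], so the line enters that ball at a nonpositive parameter. *)
  suff : dot e (x - p) <= Num.sqrt (D x) by lra.
  apply: (le_trans (ler_norm _)); rewrite -sqrtr_sqr ler_wsqrtr// lerDl.
  by rewrite mulr_ge0 ?(ltW E_gt0)// subr_ge0.
exists a => //; apply: (mulfI (lt0r_neq0 E_gt0)).
by rewrite nsq_ray fE mulr1 /f (addrC (dot _ _)) addrK sqr_sqrtr ?D_ge0// subrr add0r.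
Qed.

Lemma big_ord3_inord (V : nmodType) (f : 'I_3 -> V) :
  \sum_i f i = f (inord 0) + f (inord 1) + f (inord 2).
Proof.
rewrite !big_ord_recr big_ord0/= add0r.
by congr (f _ + f _ + f _); apply: val_inj; rewrite /= inordK.
Qed.

Lemma big_ord4_inord (V : nmodType) (f : 'I_4 -> V) :
  \sum_i f i = f (inord 0) + f (inord 1) + f (inord 2) + f (inord 3).
Proof.
rewrite !big_ord_recr big_ord0/= add0r.
by congr (f _ + f _ + f _ + f _); apply: val_inj; rewrite /= inordK.
Qed.

(* Spindle form: [w] in the ball hull of [p1, p2, q] lies in the spindle of
   [p1, z] for some [z] in the spindle of [p2, q].  Here [x] ranges over the
   centres of the unit balls. *)
Lemma ball_join p1 p2 q w :
  (forall x, nsq (x - p1) <= 1 -> nsq (x - p2) <= 1 -> nsq (x - q) <= 1 ->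
     nsq (x - w) <= 1) ->
  exists z,
    (forall x, nsq (x - p2) <= 1 -> nsq (x - q) <= 1 -> nsq (x - z) <= 1) /\
    (forall x, nsq (x - p1) <= 1 -> nsq (x - z) <= 1 -> nsq (x - w) <= 1).
Proof.
move=> Lw.
have certify a l1 l2 l3 m rho w' :
    0 <= l1 -> 0 <= l2 -> 0 <= l3 -> 0 <= m -> l1 + l2 + l3 + m = 1 ->
    l1 * nsq (a - p1) = l1 * rho ^+ 2 -> l2 * nsq (a - p2) = l2 * rho ^+ 2 ->
    l3 * nsq (a - q) = l3 * rho ^+ 2 ->
    l1 *: (a - p1) + l2 *: (a - p2) + l3 *: (a - q) = m *: (a - w') ->
    (rho = 1 /\ nsq (a - w') = 1) \/ (1 < rho /\ m = 0) ->
    exists z,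
      (forall x, nsq (x - p2) <= 1 -> nsq (x - q) <= 1 -> nsq (x - z) <= 1) /\
      (forall x, nsq (x - p1) <= 1 -> nsq (x - z) <= 1 -> nsq (x - w') <= 1).
  move=> l1_ge0 l2_ge0 l3_ge0 m_ge0 sum1 E1 E2 E3 bal cases.
  have [Z [HQ HW]] :=
    join_certificate l1_ge0 l2_ge0 l3_ge0 m_ge0 sum1 E1 E2 E3 bal cases.
  have disp x v : x - a + (a - v) = x - v by rewrite addrA subrK.
  have dispZ x : x - a + Z = x - (a - Z) by rewrite opprB addrA addrAC.
  exists (a - Z); split=> x.
    by have := HQ (x - a); rewrite !disp dispZ.
  by have := HW (x - a); rewrite !disp dispZ.
have [->|w_neq] := eqVneq w p1; first by exists q.
pose L : set 'rV[R]_d :=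
  [set x | [/\ nsq (x - p1) <= 1, nsq (x - p2) <= 1 & nsq (x - q) <= 1]].
have [L0|L0] := pselect (L !=set0); last first.
  (* [a] is the centre of the smallest ball containing [p1, p2, q]. *)
  pose P (i : 'I_3) := nth 0 [:: p1; p2; q] i.
  (* On the simplex this objective is [1 - r2], so [l] maximizes [r2]: the dual of the smallest
     enclosing ball problem. *)
  have [l [l_ge0 l_sum Hl]] :=
    simplex_lagrange (fun i => - P i) (fun i => 1 - nsq (P i)).
  pose a := \sum_i l i *: P i.
  pose r2 := \sum_i l i * nsq (P i) - nsq a.
  have a_le i : nsq (a - P i) <= r2.
    have := Hl i.
    have -> : \sum_i l i *: - P i = - a.
      by rewrite /a -sumrN; apply: eq_bigr => j _; rewrite scalerN.
    have -> : \sum_i l i * (1 - nsq (P i)) = 1 - \sum_i l i * nsq (P i).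
      by rewrite -[X in _ = X - _]l_sum -sumrB; apply: eq_bigr => j _; ring.
    by rewrite dotNl dotNr opprK nsqN nsqB /r2; lra.
  (* Complementary slackness: only points at the maximal distance carry weight. *)
  have slack : \sum_i l i * (r2 - nsq (a - P i)) = 0.
    have -> : \sum_i l i * (r2 - nsq (a - P i)) =
        (\sum_i l i) * (r2 - nsq a) + 2 * dot a (\sum_i l i *: P i)
        - \sum_i l i * nsq (P i).
      rewrite dot_sumr mulr_suml mulr_sumr -big_split/= -sumrB.
      by apply: eq_bigr => i _; rewrite nsqB; ring.
    by rewrite l_sum -/a -/(nsq a) /r2; ring.
  have El i : l i * nsq (a - P i) = l i * r2.
    apply/eqP; rewrite eq_sym -subr_eq0 -mulrBr.
    move/eqP: slack; rewrite psumr_eq0 => [/allP/(_ i)|j _].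
      by rewrite mem_index_enum => /(_ isT).
    by rewrite mulr_ge0// subr_ge0.
  have r2_gt1 : 1 < r2.
    rewrite ltNge; apply/negP => r2_le1; apply: L0; exists a.
    have H i := le_trans (a_le i) r2_le1.
    by split; [have := H (inord 0)|have := H (inord 1)|have := H (inord 2)];
       rewrite /P inordK.
  have r2E : Num.sqrt r2 ^+ 2 = r2 by rewrite sqr_sqrtr//; lra.
  apply: (certify a (l (inord 0)) (l (inord 1)) (l (inord 2)) 0 (Num.sqrt r2)) => //.
  - by rewrite addr0 -big_ord3_inord.
  - by have := El (inord 0); rewrite /P inordK// r2E.
  - by have := El (inord 1); rewrite /P inordK// r2E.
  - by have := El (inord 2); rewrite /P inordK// r2E.
  - have : \sum_i l i *: (a - P i) = 0.
      under eq_bigr do rewrite scalerBr.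
      by rewrite sumrB -scaler_suml l_sum scale1r subrr.
    by rewrite big_ord3_inord /P !inordK// scale0r.
  - by right; split=> //; rewrite -ltr_sqr ?nnegrE ?sqrtr_ge0// r2E expr1n.
have cL : compact L.
  apply: (@box_compact _ _ (fun i => p1 ord0 i - 1) (fun i => p1 ord0 i + 1)).
    have cB v : closed [set x | nsq (x - v) <= 1].
      have cv : continuous (fun x => x - v) by move=> x; exact: (cvgB cvg_id (cvg_cst _)).
      apply: (preimage_closed (f := fun x => nsq (x - v))) (@closed_le R 1).
      by move=> x _; exact: (cvg_comp _ _ (cv x) (@nsq_continuous _)).
    rewrite (_ : L = [set x | nsq (x - p1) <= 1] `&` [set x | nsq (x - p2) <= 1] `&`
      [set x | nsq (x - q) <= 1]); first by do 2![apply: closedI => //].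
    by apply/seteqP; split=> [x []|x [[]]].
  move=> x i [xp _ _]; have := le_trans (coord_le_nsq (x - p1) i) xp.
  by rewrite !mxE => H; apply/andP; split; nra.
have [s s_ge1 [Lw' [a [a1 a2 a3] aw']]] := farthest_on_ray cL L0 w_neq
  (fun x Lx => let: And3 x1 x2 x3 := Lx in conj x1 (Lw x x1 x2 x3)).
set w' := p1 + s *: (w - p1) in Lw' aw'.
(* [w] lies on the segment from [p1] to [w'], so it suffices to treat [w']. *)
have w'P x : nsq (x - p1) <= 1 -> nsq (x - w') <= 1 -> nsq (x - w) <= 1.
  move=> x1 x2.
  have s01 : 0 <= s^-1 <= 1 by rewrite invr_ge0 invf_le1; lra.
  have -> : x - w = (1 - s^-1) *: (x - p1) + s^-1 *: (x - w').
    rewrite /w' opprD addrA [s^-1 *: _]scalerBr scalerA mulVf ?gt_eqF//; last by lra.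
    by rewrite scale1r addrA -scalerDl subrK scale1r opprB addrA subrK.
  apply: (le_trans (nsq_convex _ _ s01)).
  by move/andP: s01 => [s0 s1]; nra.
(* Half gradients of the squared distances at [a], the last one reversed because [a - y] should
   approach [p1], [p2], [q] but recede from [w']; [D] holds the slacks at [a]. *)
pose U (i : 'I_4) := nth 0 [:: a - p1; a - p2; a - q; w' - a] i.
pose D (i : 'I_4) :=
  nth 0 [:: 1 - nsq (a - p1); 1 - nsq (a - p2); 1 - nsq (a - q); 0] i.
have [l [l_ge0 l_sum Hl]] := simplex_lagrange U D.
set y := \sum_i l i *: U i in Hl.
have D_ge0 i : 0 <= D i.
  by case: i => [[|[|[|[|//]]]] ?]; rewrite /D/= ?subr_ge0.
have lD_ge0 i : 0 <= l i * D i by rewrite mulr_ge0.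
have m_ge0 : 0 <= \sum_i l i * D i by exact: sumr_ge0.
have y_ge0 := nsq_ge0 y.
have K_le0 : 2 * nsq y + \sum_i l i * D i <= 0.
  rewrite leNgt; apply/negP => K_gt0.
  (* Otherwise [a - y] would be a centre in [L] too far from [w']. *)
  have Ly : L (a - y).
    have H v : 2 * nsq y + \sum_i l i * D i <= 2 * dot y (a - v) + (1 - nsq (a - v)) ->
        nsq (a - y - v) <= 1.
      rewrite (_ : a - y - v = a - v - y); last by rewrite addrAC.
      by rewrite (nsqB (a - v)) (dotC y); lra.
    by split; apply: H; [have := Hl (inord 0)|have := Hl (inord 1)|have := Hl (inord 2)];
       rewrite /U /D inordK.
  have := Lw' _ Ly; have := Hl (inord 3); rewrite /U /D inordK//= addr0.
  rewrite (_ : a - y - w' = - (y + (w' - a))); last first.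
    by rewrite (opprD y) opprB addrCA addrA.
  by rewrite nsqN (nsqD y) (nsqBC _ a) aw'; lra.
have y0 : y = 0 by apply: nsq_eq0; lra.
have lD i : l i * D i = 0.
  apply/eqP; move: (erefl (\sum_i l i * D i)) => /eqP.
  rewrite [X in _ == X](_ : _ = 0); last by lra.
  by rewrite psumr_eq0// => /allP/(_ i); rewrite mem_index_enum => /(_ isT).
have [z [z1 z2]] : exists z,
    (forall x, nsq (x - p2) <= 1 -> nsq (x - q) <= 1 -> nsq (x - z) <= 1) /\
    (forall x, nsq (x - p1) <= 1 -> nsq (x - z) <= 1 -> nsq (x - w') <= 1).
  apply: (certify a (l (inord 0)) (l (inord 1)) (l (inord 2)) (l (inord 3)) 1) => //.
  - by rewrite -big_ord4_inord.
  - by have := lD (inord 0); rewrite /D inordK//=; lra.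
  - by have := lD (inord 1); rewrite /D inordK//=; lra.
  - by have := lD (inord 2); rewrite /D inordK//=; lra.
  - move: y0; rewrite /y big_ord4_inord /U !inordK//= => /eqP.
    by rewrite addr_eq0 -scalerN opprB => /eqP.
  - by left.
by exists z; split=> // x x1 xz; apply: w'P => //; exact: z2.
Qed.

(** A unit ball containing [p1] and [p2] contains the segment between them, so [w] satisfies the
    hypothesis of [ball_join]. *)
Lemma spindle_join p1 p2 q w t : 0 <= t <= 1 ->
  spindle ((1 - t) *: p1 + t *: p2) q w ->
  exists2 z, spindle p2 q z & spindle p1 z w.
Proof.
move=> t01 /spindleP pw.
have [|z [z1 z2]] := @ball_join p1 p2 q w.
  move=> x; rewrite !(nsqBC x) => x1 x2 x3; apply: pw => //.
  by move: (spindle_segment p1 p2 t01) => /spindleP; apply.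
by exists z; apply/spindleP => c; have [] := (z1 c, z2 c); rewrite !(nsqBC c).
Qed.

End Join.

(** * Translates of [K] in the kernel of the whole intersection *)

Theorem theorem6 (R : realType) (d : nat) (K : set 'rV[R]_d)
    (F : set (set 'rV[R]_d)) :
  (forall A, F A -> spindle_starshaped A) ->
  (forall G : set (set 'rV[R]_d), G `<=` F -> countable G ->
     spindle_starshaped (\bigcap_(A in G) A) /\
     contains_translate K (skernel (\bigcap_(A in G) A))) ->
  contains_translate K (skernel (\bigcap_(A in F) A)).
Proof.
move=> _ HF.
pose I := {G : set (set 'rV[R]_d) | G `<=` F /\ countable G}.
pose mk G GF : I := exist (fun G => G `<=` F /\ countable G) G GF.
pose le (G H : I) := sval G `<=` sval H.
pose X (G : I) := \bigcap_(A in sval G) A.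
have X_anti G H : le G H -> X H `<=` X G by move=> GH x XHx A /GH/XHx.
(* Widening [G] to [H] makes [C] antitone, which the sets of translation vectors
   into [skernel (X G)] are not: shrinking a set may enlarge its kernel. *)
pose C (G : I) : set 'rV[R]_d := [set t | exists2 H, le G H &
  forall k, K k -> X G (k + t) /\ forall q, X H q -> spindle (k + t) q `<=` X G].
have le_ub (f : rat -> I) : exists U, forall r, le (f r) U.
  have HU : \bigcup_r sval (f r) `<=` F /\ countable (\bigcup_r sval (f r)).
    split=> [A [r _]|]; first by apply: (svalP (f r)).1.
    by apply: bigcup_countable => // r _; exact: (svalP (f r)).2.
  by exists (mk _ HU) => r A fA; exists r.
have [t Ct] : exists t, forall G, C G t.
  apply: (common_point le_ub).
  - move=> G H GH t [H' HH' Ht]; exists H'; first exact: subset_trans HH'.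
    move=> k /Ht[Xkt Hkt]; split=> [|q /Hkt]; first exact: X_anti GH _ Xkt.
    by move=> /subset_trans; apply; exact: X_anti.
  - move=> G; have [_ [t Kt]] := HF _ (svalP G).1 (svalP G).2.
    exists t, G => // k Kk.
    have [Xkt star] : skernel (X G) (k + t) by apply: Kt; exists k.
    by split=> // q; rewrite -{1}star => -[].
  - move=> G t [H GH Ht]; exists H => // t' l [H' HH' Ht'] l01.
    exists H' => [|k Kk]; first exact: subset_trans HH'.
    have [Xkt Hkt] := Ht k Kk; have [Xkt' Hkt'] := Ht' k Kk.
    have -> : k + ((1 - l) *: t + l *: t') = (1 - l) *: (k + t) + l *: (k + t').
      by rewrite !scalerDr addrACA -scalerDl subrK scale1r.
    split=> [|q Xq w]; first exact: (Hkt _ Xkt') (spindle_segment _ _ l01).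
    by move=> /(spindle_join l01)[z /(Hkt' _ Xq) Xz]; exact: Hkt.
exists t => _ [k Kk <-].
(* The singleton subfamilies suffice: for any widening [H], [X H] contains the whole intersection,
   so spindles to the latter stay in each [A]. *)
have star A : F A -> A (k + t) /\
    forall q, (\bigcap_(B in F) B) q -> spindle (k + t) q `<=` A.
  move=> FA.
  have HG : [set A] `<=` F /\ countable [set A] by split=> // _ ->.
  have XA : X (mk _ HG) = A by exact: bigcap_set1.
  have [H _ /(_ k Kk)] := Ct (mk _ HG); rewrite XA => -[Akt Hkt].
  by split=> // q XFq; apply: Hkt => B /(svalP H).1/XFq.
split=> [A /star[]//|]; apply/seteqP; split=> [q []//|q XFq].
by split=> // w wq A /star[_ /(_ q XFq)]; apply.
Qed.
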